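(* Let $D$ be a set and $\rho:D\to D$ an injection. There exist models $A$ and $B$ over $D$ with $A\subsetneq B$ and $A\succsim_\rho B$ if and only if $\rho$ is not a narrow permutation of $D$.
   Context: A model of computation over a set $D$ is any set of functions $f:D\to D\cup\{\bot\}$, where $\bot$ denotes ''undefined''. An encoding $\rho$ is extended by $\rho(\bot)=\bot$. Model $A$ simulates model $B$ via $\rho$, written $A\succsim_\rho B$, if for every $g\in B$ there is $f\in A$ with $\rho\circ g=f\circ\rho$. A permutation $\pi:D\to D$ is narrow if there is a constant $k\in\mathbb N$, $k\ge1$, such that $\pi^k(x)=x$ for every $x\in D$. *)

(* Defs.v *)
From mathcomp Require Import all_boot.
From mathcomp Require Import boolp classical_sets.

Set Implicit Arguments.
Unset Strict Implicit.
Unset Printing Implicit Defensive.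

Local Open Scope classical_set_scope.

(* [None] is the undefined value, so a model is an arbitrary set of partial
   functions on D; it may be empty and need not have any closure property. *)
Definition model (D : Type) : Type := set (D -> option D).

(* [omap rho] is the extension of rho that fixes the undefined value. *)
Definition simulates (D : Type) (rho : D -> D) (A B : model D) : Prop :=
  forall g, B g -> exists2 f, A f & omap rho \o g = f \o rho.

Definition narrow_permutation (D : Type) (pi : D -> D) : Prop :=
  bijective pi /\ exists2 k : nat, (1 <= k)%N & forall x, iter k pi x = x.

(* Main.v *)
Require Import Defs.
From mathcomp Require Import all_boot.
From mathcomp Require Import boolp classical_sets.

Set Implicit Arguments.
Unset Strict Implicit.
Unset Printing Implicit Defensive.

Local Open Scope classical_set_scope.

(** If [rho ^ k] is the identity, iterating the simulation [k] times puts every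
    [g] of [B] in [A].  Otherwise, let [r] send each point to a chosen
    representative of its grand orbit.  Since [r \o rho = r], the functions
    [g_n := rho ^ n \o r] satisfy [rho \o g_n = g_(n+1) \o rho], so the model
    of all [g_n] is simulated by that of the [g_n] with [n > 0].  The latter
    omits [g_0]: if [rho ^ n] fixes every representative, then by injectivity
    it is the identity. *)

Lemma iter_inj (T : Type) (f : T -> T) n : injective f -> injective (iter n f).
Proof. by move=> f_inj; elim: n => //= n IHn x y /f_inj/IHn. Qed.

(** Since [A] lies inside [B], a simulating function found in [A] can itself be simulated again. *)
Lemma simulates_iter (D : Type) (rho : D -> D) (A B : model D) :
    A `<=` B -> simulates rho A B ->
  forall n, simulates (iter n.+1 rho) A B.
Proof.
move=> AB sim; elim=> [|n IHn] g Bg; first exact: sim.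
have [f Af fE] := IHn g Bg; have [h Ah hE] := sim f (AB _ Af).
exists h => //; apply/funext => x.
have /= hEx := congr1 (@^~ (iter n.+1 rho x)) hE.
have /= fEx := congr1 (@^~ x) fE.
by rewrite /= -hEx -fEx; case: (g x).
Qed.

(** Only forward iterates are compared, as [rho] need not be surjective. *)
Definition same_grand_orbit (D : Type) (rho : D -> D) (x y : D) : Prop :=
  exists m n, iter m rho x = iter n rho y.

Lemma grand_orbit_nonempty (D : Type) (rho : D -> D) (x : D) :
  exists y, same_grand_orbit rho x y.
Proof. by exists x, 0, 0. Qed.

Definition orbit_repr (D : Type) (rho : D -> D) (x : D) : D :=
  sval (cid (grand_orbit_nonempty rho x)).

Lemma orbit_reprP (D : Type) (rho : D -> D) (x : D) :
  same_grand_orbit rho x (orbit_repr rho x).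
Proof. exact: (svalP (cid (grand_orbit_nonempty rho x))). Qed.

Lemma same_grand_orbit_step (D : Type) (rho : D -> D) (x : D) :
  same_grand_orbit rho (rho x) = same_grand_orbit rho x.
Proof.
apply/funext => y; apply/propext; split=> -[m [n e]].
  by exists m.+1, n; rewrite iterSr.
by exists m, n.+1; rewrite -iterSr /= e.
Qed.

Lemma orbit_repr_step (D : Type) (rho : D -> D) (x : D) :
  orbit_repr rho (rho x) = orbit_repr rho x.
Proof.
rewrite /orbit_repr; move: (grand_orbit_nonempty rho (rho x)).
(* The choice is made from the predicate, so equal predicates yield the same representative. *)
rewrite same_grand_orbit_step => ex.
by congr (sval (cid _)); apply: Prop_irrelevance.
Qed.

(** Some [rho ^ a] sends [x] to an iterate of its representative, which [rho ^ n] fixes too;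
    injectivity cancels [rho ^ a]. *)
Lemma iter_id_of_orbit_repr (D : Type) (rho : D -> D) n :
    injective rho ->
    (forall x, iter n rho (orbit_repr rho x) = orbit_repr rho x) ->
  forall x, iter n rho x = x.
Proof.
move=> rho_inj fix_repr x; have [a [b e]] := orbit_reprP rho x.
apply: (@iter_inj _ _ a rho_inj).
by rewrite -iterD addnC iterD e -iterD addnC iterD fix_repr.
Qed.

Lemma narrow_permutation_of_iter_id (D : Type) (rho : D -> D) n :
  (forall x, iter n.+1 rho x = x) -> narrow_permutation rho.
Proof.
move=> rho_id; split; last by exists n.+1.
by exists (iter n rho) => x; rewrite -?iterS -?iterSr rho_id.
Qed.

Theorem mainTheorem6 (D : Type) (rho : D -> D) (rho_inj : injective rho) :
  (exists A B : model D, A `<` B /\ simulates rho A B) <->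
  ~ narrow_permutation rho.
Proof.
split=> [[A [B [[AB nBA] sim]]] [_ [[//|k] _ rho_id]]|not_narrow].
  apply: nBA => g Bg; have [f Af fE] := simulates_iter AB sim k Bg.
  suff -> : g = f by [].
  apply/funext => x; have := congr1 (@^~ x) fE.
  by rewrite /= -iterS rho_id => <-; case: (g x) => //= y; rewrite -iterS rho_id.
pose g n x := Some (iter n rho (orbit_repr rho x)).
exists [set g n.+1 | n in setT], (range g); split; last first.
  move=> _ [n _ <-]; exists (g n.+1); first by exists n.
  by apply/funext => x; rewrite /g /= orbit_repr_step.
split=> [_ [n _ <-]|/(_ (g 0))]; first by exists n.+1.
(* If [g 0] were in the smaller model, it would equal some [g n.+1], with a positive exponent. *)
case=> [|n _ gE]; first by exists 0.
apply/not_narrow/(@narrow_permutation_of_iter_id _ _ n).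
apply: iter_id_of_orbit_repr => // x.
by have [] := congr1 (@^~ x) gE.
Qed.
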